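(* Let ${\bf E}$ be the $n$-dimensional evolution algebra over $\mathbb K$ with natural basis $\{{\bf e}_i\}_{i=1}^n$ and structural matrix $A=(a_{i,j})$ in normal form, and let $\mathcal I_A=\{(i,j): i+1<j<n,\ a_{i,j}\neq 0\}$. Let $R$ be a linear operator on ${\bf E}$ and let $f(x)=\frac{x^2}{2x+1}$. Then $R\in\mathcal{RB}_1^{\vartriangle}({\bf E})$ if and only if it has the following form. (i) If $\mathcal I_A=\emptyset$: for some $\alpha\in\mathbb K\setminus\bigcup_{k=0}^{n-2}f^{-k}(-\tfrac12)$ and $\beta\in\mathbb K$, $$R({\bf e}_1)=\alpha{\bf e}_1+\beta{\bf e}_n,\qquad R({\bf e}_i)=f^{i-1}(\alpha){\bf e}_i\quad (i>1).$$ (ii) If $\mathcal I_A\neq\emptyset$: put $i_0=\min\{i:\exists j\text{ such that }(i,j)\in\mathcal I_A\}$, $I_1=\{j-i-1:(i,j)\in\mathcal I_A\}$, $I_2=\{|k-j|: k\ne j,\ \exists i\text{ such that }(i,j),(i,k)\in\mathcal I_A\}$, and $m=\gcd(I_1\cup I_2)$. Then for some $\alpha\in Per_m(f)$ and $\beta\in\mathbb K$, $$R({\bf e}_1)=f^{-i_0}(\alpha){\bf e}_1+\beta{\bf e}_n,\qquad R({\bf e}_i)=f^{i-i_0-1}(\alpha){\bf e}_i\quad (i>1),$$ where the values with negative exponents denote a compatible choice of successive preimages in $\mathbb K$; that is, there are $\lambda_1,\dots,\lambda_n\in\mathbb K$ with $\lambda_{i_0+1}=\alpha$, and $\lambda_i\ne-\frac12$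 and $f(\lambda_i)=\lambda_{i+1}$ for all $1\le i<n$, such that $R({\bf e}_1)=\lambda_1{\bf e}_1+\beta{\bf e}_n$ and $R({\bf e}_i)=\lambda_i{\bf e}_i$ for $i>1$.
   Context: $\mathbb K$ is $\mathbb R$ or $\mathbb C$. The evolution algebra with natural basis $\{{\bf e}_i\}_{i=1}^n$ and structural matrix $A=(a_{i,j})$ is the algebra with bilinear multiplication ${\bf e}_i{\bf e}_j={\bf 0}$ for $i\neq j$ and ${\bf e}_i^2=\sum_{j}a_{i,j}{\bf e}_j$. ''Normal form'' means $A$ is strictly upper triangular ($a_{i,j}=0$ for $j\le i$), $a_{i,i+1}=1$ for all $i<n$, and $a_{i,n}=0$ for all $i\le n-2$; the remaining entries $a_{i,j}\in\mathbb K$ ($i+1<j<n$) are arbitrary. A linear map $R:{\bf E}\to{\bf E}$ is a Rota-Baxter operator of weight $1$ if $R({\bf x})R({\bf y})=R(R({\bf x}){\bf y}+{\bf x}R({\bf y})+{\bf x}{\bf y})$ for all ${\bf x},{\bf y}\in{\bf E}$. Write $R({\bf e}_i)=\sum_{k}r_{i,k}{\bf e}_k$ (every such $R$ has $r_{i,k}=0$ for $k<i$). $\mathcal{RB}_1^{\vartriangle}({\bf E})$ is the set of Rota-Baxter operators $R$ of weight $1$ on ${\bf E}$ with $r_{i,j}=0$ for all $i<j<n$. $f^k$ is the $k$-fold composition of $f$ ($f^0=\mathrm{id}$), defined at points where no intermediate value equals $-\frac12$; $f^{-k}(-\frac12)$ is the set of $x\in\mathbb K$ for which $f^k(x)$ is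 defined and equals $-\frac12$. $Per_m(f)=\{x\in\mathbb K: f^m(x)\text{ is defined and }f^m(x)=x\}$. *)

(* Defs.v *)
From HB Require Import structures.
From mathcomp Require Import all_boot all_order all_algebra.
From mathcomp Require Import reals complex.

Set Implicit Arguments.
Unset Strict Implicit.
Unset Printing Implicit Defensive.

Import GRing.Theory.
Local Open Scope ring_scope.

(* Indices start at 0: index i here is index i + 1 in the usual convention,  *)
(* where bases are numbered e_1, ..., e_n.                                   *)

(* The ground field is either the reals or the complex numbers. *)
Variant ground := RealField | ComplexField.

Definition scalars (F : realType) (g : ground) : fieldType :=
  match g with
  | RealField => F
  | ComplexField => F[i]%C
  end.

Section EvolutionAlgebra.
Variables (K : fieldType) (n : nat) (A : 'M[K]_n).

Definition normal_form : Prop :=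
  [/\ forall i j : 'I_n, (j <= i)%N -> A i j = 0,
      forall i j : 'I_n, j = i.+1 :> nat -> A i j = 1
    & forall i j : 'I_n, (i.+2 < n)%N -> j.+1 = n -> A i j = 0].

Definition index_set : {set 'I_n * 'I_n} :=
  [set p : 'I_n * 'I_n |
    [&& (p.1.+1 < p.2)%N, (p.2.+1 < n)%N & A p.1 p.2 != 0]].

(* The default value n is taken only when [index_set] is empty. *)
Definition i_min : nat := \big[minn/n]_(p in index_set) p.1.

(* Positive differences of indices below n are again below n, so [I1] and    *)
(* [I2] are sets of ordinals.                                                *)
Definition I1 : {set 'I_n} :=
  [set d : 'I_n | [exists i : 'I_n, exists j : 'I_n,
    ((i, j) \in index_set) && (d == (j - i - 1)%N :> nat)]].

Definition I2 : {set 'I_n} :=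
  [set d : 'I_n | [exists i : 'I_n, exists j : 'I_n, exists k : 'I_n,
    [&& (i, j) \in index_set, (i, k) \in index_set, k != j
      & d == `|k - j|%N :> nat]]].

Definition period_gcd : nat := \big[gcdn/0%N]_(d in I1 :|: I2) d.

Variables (E : vectType K) (e : n.-tuple E) (mul : {bilinear E -> E -> E}).

Definition evolution_algebra : Prop :=
  [/\ basis_of fullv e,
      forall i j : 'I_n, i != j -> mul e`_i e`_j = 0
    & forall i : 'I_n, mul e`_i e`_i = \sum_(j < n) A i j *: e`_j].

Definition rota_baxter1 (R : 'End(E)) : Prop :=
  forall x y : E, mul (R x) (R y) = R (mul (R x) y + mul x (R y) + mul x y).

Definition RB1_triangle (R : 'End(E)) : Prop :=
  rota_baxter1 R /\
  forall i j : 'I_n, (i < j)%N -> (j.+1 < n)%N -> coord e j (R e`_i) = 0.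

End EvolutionAlgebra.

Section Dynamics.
Variable K : fieldType.

(* The field division is total, so the value of [f] at [pole] is junk;       *)
(* [f_defined] keeps orbits away from it.                                    *)
Definition f (x : K) : K := x ^+ 2 / (2%:R * x + 1).

Definition pole : K := - (1 / 2%:R).

Definition f_defined (k : nat) (x : K) : Prop :=
  forall l, (l < k)%N -> iter l f x != pole.

Definition f_preimage_pole (k : nat) (x : K) : Prop :=
  f_defined k x /\ iter k f x = pole.

Definition Per (m : nat) (x : K) : Prop :=
  f_defined m x /\ iter m f x = x.

End Dynamics.

(* Main.v *)
Require Import Defs.
From HB Require Import structures.
From mathcomp Require Import all_boot all_order all_algebra.
From mathcomp Require Import reals complex.
From mathcomp Require Import ring zify.

Set Implicit Arguments.
Unset Strict Implicit.
Unset Printing Implicit Defensive.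

Import GRing.Theory.
Local Open Scope ring_scope.

(** Why the theorem holds.  Let r_i be the diagonal entries of R in the
    natural basis, and f(x) = x^2 / (2x + 1).

    The Rota-Baxter identity at (e_i, e_i) says that the combination of the
    squares e_k^2 with coefficients r_ik^2 equals (2 r_i + 1) R(e_i^2).  In
    normal form the squares of all basis vectors but the last are linearly
    independent, so r_i = -1/2 is impossible for them: it would force
    r_i^2 = 0.  Hence R maps the span of the squares, which is the span of
    e_2, ..., e_n, into itself; repeating the argument on the tails shows that
    R is upper triangular ([RB1_matrix_upper]).  With the vanishing imposed by
    the triangle condition, R is diagonal up to its last column, and the same
    identity becomes R(e_i^2) = f(r_i) e_i^2 ([op_square_eigen]): the square
    of e_i is an eigenvector.  Reading this off coordinate by coordinate gives
    - r_(i+1) = f(r_i), from the entry a_(i,i+1) = 1;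
    - r_j = r_(i+1) whenever a_(i,j) <> 0 with i + 1 < j < n;
    - no off-diagonal entry in the last column, except in the first row, whose
      basis vector occurs in no square.
    These conditions are necessary ([RB1_triangle_orbit]) and give back the
    identity ([compatible_orbit_RB1]).

    What remains is about orbits of f.  If there is no extra nonzero a_(i,j),
    an orbit of length n avoiding -1/2 is determined by its first point.
    Otherwise r_j = r_(i+1) says that r_(i+1) has period j - i - 1.  The point
    alpha at position i_0 + 1 is itself periodic, so its orbit is a cycle on
    which every later r_(i+1) lies; all points of a cycle have the same
    periods, so alpha has all the periods j - i - 1, and their
    differences, which form I_2, hence the gcd of all of them
    ([compatible_orbit_Per]). *)

(** * Rota-Baxter operators in coordinates *)

(** The coordinate at e_l of the Rota-Baxter identity at (e_i, e_j), for an
    operator with matrix [M] acting on row vectors: row i of [A *m M] is the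
    image of e_i^2. *)
Definition RB1_matrix (K : fieldType) (n : nat) (A M : 'M[K]_n) : Prop :=
  forall i j l, \sum_k M i k * M j k * A k l
    = M i j * (A *m M) j l + M j i * (A *m M) i l
      + (i == j)%:R * (A *m M) i l.

Definition op_matrix (K : fieldType) (n : nat) (E : vectType K)
    (e : n.-tuple E) (R : 'End(E)) : 'M[K]_n :=
  \matrix_(i, k) coord e k (R e`_i).

Section OperatorToMatrix.
Variables (K : fieldType) (n : nat) (A : 'M[K]_n).
Variables (E : vectType K) (e : n.-tuple E) (mul : {bilinear E -> E -> E}).
Hypothesis E_evol : evolution_algebra A e mul.
Variable R : 'End(E).
Let M := op_matrix e R.

Let e_basis : basis_of fullv e. Proof. by case: E_evol. Qed.

Lemma op_matrixE i : R e`_i = \sum_k coord e k (R e`_i) *: e`_k.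
Proof. exact: (coord_basis e_basis (memvf _)). Qed.

Lemma op_matrix_row (i : 'I_n) : R e`_i = \sum_k M i k *: e`_k.
Proof. by rewrite op_matrixE; apply: eq_bigr => k _; rewrite mxE. Qed.

Lemma basis_comb_inj (c d : 'I_n -> K) :
  \sum_k c k *: e`_k = \sum_k d k *: e`_k -> c =1 d.
Proof.
move=> cd k; have free_e := basis_free e_basis.
by rewrite -(coord_sum_free c k free_e) cd coord_sum_free.
Qed.

Lemma mul_basis (i j : 'I_n) :
  mul e`_i e`_j = (i == j)%:R *: \sum_(l < n) A i l *: e`_l.
Proof.
case: E_evol => _ ort sq; case: eqVneq => [->|ij]; first by rewrite sq scale1r.
by rewrite ort // scale0r.
Qed.

Lemma mul_comb (c d : 'I_n -> K) :
  mul (\sum_k c k *: e`_k) (\sum_k d k *: e`_k)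
    = \sum_l (\sum_k c k * d k * A k l) *: e`_l.
Proof.
rewrite (linear_sumlz mul).
under eq_bigr => i _.
  rewrite (linear_sumr mul) (bigD1 i) //= big1 => [|j ij]; last first.
    rewrite linearZl_LR linearZr_LR /= mul_basis eq_sym (negPf ij).
    by rewrite scale0r !scaler0.
  rewrite addr0 linearZl_LR linearZr_LR /= mul_basis eqxx scale1r scalerA.
  rewrite scaler_sumr.
  under eq_bigr => l _ do rewrite scalerA.
  over.
by rewrite exchange_big; apply: eq_bigr => l _; rewrite scaler_suml.
Qed.

Lemma op_square (i : 'I_n) :
  R (\sum_(l < n) A i l *: e`_l) = \sum_l (A *m M) i l *: e`_l.
Proof.
rewrite linear_sum.
under eq_bigr => j _ do rewrite linearZ /= op_matrix_row scaler_sumr.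
rewrite exchange_big; apply: eq_bigr => l _; rewrite mxE scaler_suml.
by apply: eq_bigr => k _; rewrite scalerA.
Qed.

Let mul_l i (j : 'I_n) : mul (R e`_i) e`_j
   = coord e j (R e`_i) *: \sum_(l < n) A j l *: e`_l.
Proof.
rewrite op_matrixE (linear_sumlz mul) (bigD1 j) //= big1 => [|k kj].
  by rewrite addr0 linearZl_LR /= mul_basis eqxx scale1r -op_matrixE.
by rewrite linearZl_LR /= mul_basis (negPf kj) scale0r scaler0.
Qed.

Let mul_r (i : 'I_n) j : mul e`_i (R e`_j)
   = coord e i (R e`_j) *: \sum_(l < n) A i l *: e`_l.
Proof.
rewrite op_matrixE (linear_sumr mul) (bigD1 i) //= big1 => [|k kj].
  by rewrite addr0 linearZr_LR /= mul_basis eqxx scale1r -op_matrixE.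
by rewrite linearZr_LR /= mul_basis eq_sym (negPf kj) scale0r scaler0.
Qed.

(** Both sides of the identity are bilinear in (x, y). *)
Lemma rota_baxter1_basis :
  rota_baxter1 mul R <->
  forall i j : 'I_n, mul (R e`_i) (R e`_j)
    = R (mul (R e`_i) e`_j + mul e`_i (R e`_j) + mul e`_i e`_j).
Proof.
split=> [RB i j|RB x y]; first exact: RB.
rewrite (coord_basis e_basis (memvf x)); move: (coord e ^~ x) => c.
rewrite [R (\sum_i _)]linear_sum !(linear_sumlz mul) -!big_split linear_sum /=.
apply: eq_bigr => i _.
rewrite (coord_basis e_basis (memvf y)); move: (coord e ^~ y) => d.
rewrite [R (\sum_i _)]linear_sum !(linear_sumr mul) -!big_split linear_sum /=.
apply: eq_bigr => j _.
rewrite ![R (_ *: _)]linearZ /= !(linearZr_LR mul) /= !(linearZl_LR mul) /= RB.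
by rewrite -!scalerDr; do 2!rewrite [R (_ *: _)]linearZ /=.
Qed.

Lemma rota_baxter1_matrix : rota_baxter1 mul R <-> RB1_matrix A M.
Proof.
rewrite rota_baxter1_basis.
have rhs (i j : 'I_n) :
  R (mul (R e`_i) e`_j + mul e`_i (R e`_j) + mul e`_i e`_j)
    = \sum_l (M i j * (A *m M) j l + M j i * (A *m M) i l
      + (i == j)%:R * (A *m M) i l) *: e`_l.
  rewrite mul_l mul_r mul_basis !linearD !linearZ /= !op_square.
  rewrite !scaler_sumr -!big_split /=; apply: eq_bigr => l _.
  by rewrite !scalerA !mxE -!scalerDl.
split=> [RB i j l | RB i j].
  have := RB i j; rewrite rhs [in LHS]op_matrix_row [R e`_j]op_matrix_row.
  by rewrite mul_comb => /basis_comb_inj /(_ l).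
rewrite rhs [in LHS]op_matrix_row [R e`_j]op_matrix_row mul_comb.
by apply: eq_bigr => l _; rewrite RB.
Qed.

End OperatorToMatrix.

(** * Solving the matrix equations in normal form *)

Section MatrixEquations.
Variables (K : fieldType) (n : nat) (A M : 'M[K]_n.+1).
Hypothesis two_neq0 : (2%:R : K) != 0.
Hypothesis A_normal : normal_form A.

Let A_low (i j : 'I_n.+1) : (j <= i)%N -> A i j = 0.
Proof. by case: A_normal => H _ _; apply: H. Qed.

Lemma pole_eq (x : K) : (x == pole K) = (2%:R * x + 1 == 0).
Proof.
rewrite /pole addr_eq0; apply/eqP/eqP => [->|]; first by field.
by move/(canRL (mulKf two_neq0)) => ->; field.
Qed.

(** The squares of the basis vectors other than the last one form an echelon
    family, the leading term of e_k^2 being e_(k+1) with coefficient 1. *)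
Lemma squares_independent (c : 'I_n.+1 -> K) :
  (forall l, \sum_k c k * A k l = 0) ->
  forall k : 'I_n.+1, (k < n)%N -> c k = 0.
Proof.
move=> c0 k; have [b] := ubnP (k : nat); elim: b k => // b IHb k /= kb kn.
have kn' : (k.+1 < n.+1)%N by [].
have := c0 (Ordinal kn'); rewrite (bigD1 k) //=.
case: A_normal => _ -> // _; rewrite mulr1 big1 ?addr0 // => j jk.
case: (ltnP j k) => [jltk|kj]; first by rewrite IHb ?mul0r //; lia.
by rewrite A_low ?mulr0 // ltn_neqAle eq_sym jk.
Qed.

Hypothesis RB : RB1_matrix A M.

Lemma RB1_matrix_diag i l :
  \sum_k M i k ^+ 2 * A k l = (2%:R * M i i + 1) * (A *m M) i l.
Proof. by have := RB i i l; rewrite eqxx mul1r => ->; ring. Qed.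

(** At [M i i] = -1/2 the right-hand side of [RB1_matrix_diag] vanishes, so
    independence of the squares gives [M i i] = 0, which is absurd. *)
Lemma diag_neq_pole (i : 'I_n.+1) : (i < n)%N -> M i i != pole K.
Proof.
move=> ltin; rewrite pole_eq; apply/negP => /eqP Mii.
have Mi0 : M i i = 0.
  apply/eqP; rewrite -sqrf_eq0; apply/eqP.
  apply: (squares_independent (c := fun k => M i k ^+ 2)) ltin => l.
  by rewrite RB1_matrix_diag Mii mul0r.
by move/eqP: Mii; rewrite Mi0 mulr0 add0r oner_eq0.
Qed.

(** Let V_s be the span of the basis vectors of index at least [s].  If V_s is
    stable, then for k in this range the image of e_k^2 is, up to the nonzero
    factor 2 [M k k] + 1, a combination of squares of vectors of V_s, hence
    lies in V_(s+1).  These squares span V_(s+1), which is therefore stable. *)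
Lemma RB1_matrix_upper (i k : 'I_n.+1) : (k < i)%N -> M i k = 0.
Proof.
suff tail s : forall i k : 'I_n.+1, (s <= i)%N -> (k < s)%N -> M i k = 0.
  by move=> ki; apply: (tail i).
elim: s => // s IHs {}i {}k.
(* Downward on i: e_i is e_(i-1)^2 minus a combination of later vectors. *)
have [b] := ubnP (n - i); elim: b i => // b IHb i /= ib si ks.
have i1 : (i.-1 < n.+1)%N by have := ltn_ord i; lia.
pose i' := Ordinal i1.
have i'n : (i' < n)%N by have := ltn_ord i; rewrite /=; lia.
have Ai'i : A i' i = 1 by case: A_normal => _ -> //=; lia.
have -> : M i k = (A *m M) i' k.
  rewrite mxE (bigD1 i) //= Ai'i mul1r big1 ?addr0 // => j ji.
  case: (leqP j i') => [ji'|i'j]; first by rewrite A_low ?mul0r.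
  have {}ji : (j : nat) != i by [].
  have [nj sj] : (n - j < b)%N /\ (s < j)%N.
    by have := ltn_ord j; move: i'j => /=; lia.
  by rewrite IHb ?mulr0.
have: (2%:R * M i' i' + 1) * (A *m M) i' k = 0.
  rewrite -RB1_matrix_diag big1 // => j _.
  case: (ltnP j s) => [js|sj]; last by rewrite A_low ?mulr0 //; lia.
  by rewrite (IHs i') ?expr0n ?mul0r //=; lia.
by move/eqP; rewrite mulf_eq0 -pole_eq (negPf (diag_neq_pole i'n)) => /eqP.
Qed.

Hypothesis M_tri : forall i j : 'I_n.+1, (i < j)%N -> (j < n)%N -> M i j = 0.

Let M_off (i k : 'I_n.+1) : k != i -> (k < n)%N -> M i k = 0.
Proof.
rewrite -val_eqE /= neq_ltn => /orP[ki _|]; first exact: RB1_matrix_upper.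
exact: M_tri.
Qed.

Let A_last (l : 'I_n.+1) : A ord_max l = 0.
Proof. by apply: A_low; rewrite -ltnS. Qed.

(** The square of e_i is an eigenvector with eigenvalue f([M i i]): off the
    diagonal, row i of [M] only has a last entry, and e_n^2 = 0. *)
Lemma op_square_eigen (i l : 'I_n.+1) : (i < n)%N ->
  (A *m M) i l = f (M i i) * A i l.
Proof.
move=> ltin; have Mii : 2%:R * M i i + 1 != 0.
  by rewrite -pole_eq diag_neq_pole.
apply: (mulfI Mii); rewrite -RB1_matrix_diag (bigD1 i) //= big1 ?addr0.
  by rewrite /f; field.
move=> k ki; case: (ltnP k n) => kn.
  by rewrite M_off ?expr0n ?mul0r.
have -> : k = ord_max by apply: val_inj => /=; have := ltn_ord k; lia.
by rewrite A_last mulr0.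
Qed.

Lemma op_square_diag (i l : 'I_n.+1) : (l < n)%N ->
  (A *m M) i l = A i l * M l l.
Proof.
move=> ln; rewrite mxE (bigD1 l) //= big1 ?addr0 // => k kl.
by rewrite M_off ?mulr0 // eq_sym.
Qed.

(** The two expressions for the image of e_i^2 are compared at e_j, where
    [A i j] = 1.  If j is the last index then i is the last but one, so that
    e_i^2 = e_j, and the last column of [M] does not interfere. *)
Lemma diag_succ (i j : 'I_n.+1) : j = i.+1 :> nat -> M j j = f (M i i).
Proof.
move=> ji; have ltin : (i < n)%N by have := ltn_ord j; lia.
have Aij : A i j = 1 by case: A_normal => _ ->.
have := op_square_eigen j ltin; rewrite Aij mulr1 => <-.
case: (ltnP j n) => jn; first by rewrite op_square_diag // Aij mul1r.
rewrite mxE (bigD1 j) //= Aij mul1r big1 ?addr0 // => k kj.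
have {}kj : (k : nat) != j by [].
by rewrite A_low ?mul0r //; have := ltn_ord k; have := ltn_ord j; lia.
Qed.

Lemma diag_support (i j : 'I_n.+1) :
  (i, j) \in index_set A -> M j j = f (M i i).
Proof.
rewrite inE /= => /and3P[ij jn Aij].
have ltin : (i < n)%N by lia.
have := op_square_eigen j ltin; rewrite op_square_diag 1?mulrC; last by lia.
exact: mulIf.
Qed.

(** With i = k - 1, the eigenvector e_i^2 has no component along the last
    basis vector, so neither has its image; since e_i^2 is e_k plus later
    vectors, downward induction on k applies. *)
Lemma last_column (k : 'I_n.+1) : (0 < k < n)%N -> M k ord_max = 0.
Proof.
have [b] := ubnP (n - k); elim: b k => // b IHb k /= kb /andP[k0 kn].
have i1 : (k.-1 < n.+1)%N by have := ltn_ord k; lia.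
pose i := Ordinal i1.
have ltin : (i < n)%N by have := ltn_ord k; rewrite /=; lia.
have := op_square_eigen ord_max ltin.
have -> : A i ord_max = 0 by case: A_normal => _ _ -> //=; lia.
have Aik : A i k = 1 by case: A_normal => _ -> //=; lia.
rewrite mulr0 mxE (bigD1 k) //= Aik mul1r big1 ?addr0 // => j jk.
have {}jk : (j : nat) != k by [].
case: (leqP j i) => [ji|ij]; first by rewrite A_low ?mul0r.
case: (ltnP j n) => jn.
  have nj : (n - j < b)%N by move: ij => /=; lia.
  have j_gt0 : (0 < j)%N by apply: leq_trans ij.
  by rewrite IHb ?mulr0 ?j_gt0.
have -> : j = ord_max by apply: val_inj => /=; have := ltn_ord j; lia.
have -> : A i ord_max = 0 by case: A_normal => _ _ -> //=; lia.
by rewrite mul0r.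
Qed.

End MatrixEquations.

(** * Operators and orbits of f *)

Definition compatible_orbit (K : fieldType) (n : nat) (A : 'M[K]_n)
    (r : nat -> K) : Prop :=
  (forall i, (i.+1 < n)%N -> r i != pole K /\ f (r i) = r i.+1)
  /\ (forall i j : 'I_n, (i, j) \in index_set A -> r j = r i.+1).

Section Classification.
Variables (K : fieldType) (n : nat) (A : 'M[K]_n.+1).
Variables (E : vectType K) (e : n.+1.-tuple E) (mul : {bilinear E -> E -> E}).
Hypothesis two_neq0 : (2%:R : K) != 0.
Hypothesis E_evol : evolution_algebra A e mul.
Hypothesis A_normal : normal_form A.
Variable R : 'End(E).
Let M := op_matrix e R.

Lemma RB1_triangle_orbit :
  RB1_triangle e mul R ->
  exists (r : nat -> K) (beta : K),
    [/\ compatible_orbit A r, R e`_0 = r 0%N *: e`_0 + beta *: e`_n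
      & forall i, (0 < i < n.+1)%N -> R e`_i = r i *: e`_i].
Proof.
case=> /(rota_baxter1_matrix E_evol); rewrite -/M => RB tri.
have M_tri (i j : 'I_n.+1) : (i < j)%N -> (j < n)%N -> M i j = 0.
  by move=> ij jn; rewrite mxE tri.
have M_up := RB1_matrix_upper two_neq0 A_normal RB.
have M_last := last_column two_neq0 A_normal RB M_tri.
pose r i := M (inord i) (inord i).
have rE (i : 'I_n.+1) : r i = M i i by rewrite /r inord_val.
have row (i : 'I_n.+1) : i != ord_max ->
    R e`_i = r i *: e`_i + M i ord_max *: e`_n.
  move=> i_n; rewrite (op_matrix_row E_evol) (bigD1 i) //= (bigD1 ord_max) /=.
    rewrite big1 ?addr0 ?rE // => k /andP[ki kn].
    have {}kn : (k < n)%N.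
      have := ltn_ord k; rewrite ltnS leq_eqVlt => /orP[/eqP kE|//].
      by case/eqP: kn; apply: val_inj.
    case: (ltnP k i) => [/M_up ->|ik]; first by rewrite scale0r.
    by rewrite -/M M_tri ?scale0r // ltn_neqAle eq_sym ki.
  by rewrite eq_sym.
have row_last k : k = n -> R e`_k = r k *: e`_k.
  move=> ->; rewrite -[n in e`_n]/(nat_of_ord (@ord_max n)).
  rewrite (op_matrix_row E_evol).
  rewrite (bigD1 ord_max) //= big1 ?addr0 -?rE // => {}k kn.
  rewrite -/M M_up ?scale0r //= ltn_neqAle -ltnS ltn_ord andbT.
  by apply: contra kn => /eqP kn; apply/eqP/val_inj.
(* In dimension 1 the first and last basis vectors coincide, and the whole
   entry is put in r. *)
exists r, (if (0 < n)%N then M ord0 ord_max else 0); split.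
- split=> [i ltin|i j ij]; last first.
    have /and3P[/= i1 jn _] : [&& (i.+1 < j)%N, (j.+1 < n.+1)%N & A i j != 0].
      by move: ij; rewrite inE.
    have i1n : (i.+1 < n.+1)%N by lia.
    rewrite rE -[i.+1]/(nat_of_ord (Ordinal i1n)) rE.
    by rewrite (diag_support two_neq0 A_normal RB M_tri ij)
      (diag_succ two_neq0 A_normal RB M_tri
        (i := i) (j := Ordinal i1n)).
  pose i0 := Ordinal (ltnW ltin); pose i1 := Ordinal ltin.
  rewrite (rE i0 : r i = _) (rE i1 : r i.+1 = _); split.
    exact: (diag_neq_pole two_neq0 A_normal RB).
  by rewrite (diag_succ two_neq0 A_normal RB M_tri (i := i0) (j := i1)).
- case: (posnP n) => [n0|n_gt0]; first by rewrite scale0r addr0 row_last.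
  by have := row ord0; rewrite -val_eqE /= => -> //; rewrite eq_sym -lt0n.
- move=> i /andP[i0 ltin].
  have [/row_last//|i_n] := eqVneq i n.
  have := row (Ordinal ltin); rewrite -val_eqE /= => -> //.
  by rewrite M_last ?scale0r ?addr0 //=; lia.
Qed.

Lemma compatible_orbit_RB1 (r : nat -> K) (beta : K) :
  compatible_orbit A r ->
  R e`_0 = r 0%N *: e`_0 + beta *: e`_n ->
  (forall i, (0 < i < n.+1)%N -> R e`_i = r i *: e`_i) ->
  RB1_triangle e mul R.
Proof.
move=> [r_orb r_supp] R0 Ri.
have [A_low _ A_last] := A_normal.
have free_e : free e by apply: (@basis_free _ _ fullv); case: E_evol.
(* The extra entry beta sits in the last column of the first row; ME excludes
   it, while in MA and MMA it is multiplied by the last row of A, which is 0. *)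
have ME (i k : 'I_n.+1) : ((k < n) || (0 < i))%N -> M i k = (i == k)%:R * r i.
  have coordE (j : 'I_n.+1) : coord e k e`_j = (j == k)%:R.
    by rewrite (coord_free _ _ free_e) eq_sym.
  move=> ik; rewrite mxE; case: (posnP i) => i0; last first.
    by rewrite Ri ?i0 ?ltn_ord // linearZ /= coordE mulrC.
  rewrite i0 orbF in ik; rewrite i0 R0 linearD !linearZ /=.
  rewrite (coordE ord0 : coord e k e`_0 = _).
  rewrite (coordE ord_max : coord e k e`_n = _).
  have -> : (ord_max == k) = false by rewrite -val_eqE /=; lia.
  have -> : i = ord0 by apply: val_inj.
  by rewrite mulr0 addr0 mulrC.
have AM i l : (A *m M) i l = A i l * r l.
  rewrite mxE (bigD1 l) //= big1 ?addr0 => [|k kl].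
    case: (posnP l) => l0; first by rewrite A_low ?mul0r ?l0.
    by rewrite ME ?eqxx ?mul1r ?l0 ?orbT.
  case: (posnP k) => k0; first by rewrite A_low ?mul0r ?k0.
  by rewrite ME ?k0 ?orbT // (negPf kl) mul0r mulr0.
have last0 (i l : 'I_n.+1) : ~~ (i < n)%N -> A i l = 0.
  by move=> i_n; apply: A_low; have := ltn_ord l; lia.
split=> [|i j ij jn]; last first.
  have := ME i j; rewrite mxE => ->; last by rewrite -ltnS jn.
  have -> : (i == j) = false by rewrite -val_eqE /=; lia.
  by rewrite mul0r.
apply/(rota_baxter1_matrix E_evol) => i j l; rewrite -/M.
have MA (p q : 'I_n.+1) : M p q * A q l = (p == q)%:R * r p * A q l.
  by case: (boolP (q < n)%N) => qn; [rewrite ME ?qn|rewrite last0 ?mulr0].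
have MMA q : M i q * M j q * A q l
    = (i == q)%:R * r i * ((j == q)%:R * r j) * A q l.
  by case: (boolP (q < n)%N) => qn; [rewrite !ME ?qn|rewrite last0 ?mulr0].
rewrite !AM !mulrA !MA (bigD1 i) //= big1 ?addr0 => [|k ki]; last first.
  by rewrite MMA eq_sym (negPf ki) !mul0r.
rewrite MMA eqxx [j == i]eq_sym.
case: (eqVneq i j) => [<-|_]; last by rewrite !(mul0r, mulr0, addr0).
have [->|Ail] := eqVneq (A i l) 0; first by ring.
have ltil : (i < l)%N by rewrite ltnNge; apply: contra Ail => /A_low ->.
have i1n : (i.+1 < n.+1)%N by have := ltn_ord l; lia.
have [i_pole ri] := r_orb i i1n.
have -> : r l = f (r i).
  have [li|li] := eqVneq (l : nat) i.+1; first by rewrite li ri.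
  rewrite ri; apply: r_supp; rewrite inE /= Ail andbT; apply/andP; split.
    by lia.
  case: (ltnP l n) => // nl; case/eqP: Ail; apply: A_last.
    by have := ltn_ord l; lia.
  by have := ltn_ord l; lia.
rewrite pole_eq // in i_pole; rewrite !mulr1n /f; field.
exact: i_pole.
Qed.

End Classification.

(** * Periods *)

Section Periods.
Variables (T : Type) (h : T -> T) (x : T).

Lemma iter_period_mul (d q : nat) : iter d h x = x -> iter (q * d) h x = x.
Proof. by move=> dx; elim: q => //= q IHq; rewrite mulSn iterD IHq. Qed.

Lemma iter_period_sub (d d' : nat) :
  iter d h x = x -> iter (d' + d) h x = x -> iter d' h x = x.
Proof. by move=> dx; rewrite iterD dx. Qed.

(** By Bezout, the gcd is a difference of multiples of the two periods. *)
Lemma iter_period_gcd (d d' : nat) :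
  iter d h x = x -> iter d' h x = x -> iter (gcdn d d') h x = x.
Proof.
move=> dx d'x; have [->|d_gt0] := posnP d; first by rewrite gcd0n.
have [u v uv _] := egcdnP d' d_gt0.
apply: (iter_period_sub (d := v * d')); first exact: iter_period_mul.
by rewrite addnC -uv; apply: iter_period_mul.
Qed.

(** All points of a cycle have the same periods: the cycle leads from
    [iter s h x] back to [x]. *)
Lemma iter_period_shift (d q s : nat) :
  iter (s + q) h x = x -> iter d h (iter s h x) = iter s h x ->
  iter d h x = x.
Proof.
move=> sqx dx; rewrite -{1}sqx addnC iterD -iterD addnC iterD dx.
by rewrite -iterD addnC.
Qed.

End Periods.

(** * The index set and compatible orbits *)

Section IndexSet.
Variables (K : fieldType) (n : nat) (A : 'M[K]_n).

Lemma index_setP (i j : 'I_n) :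
  (i, j) \in index_set A -> (i.+1 < j)%N /\ (j.+1 < n)%N.
Proof. by rewrite inE => /and3P[]. Qed.

Lemma i_min_le (p : 'I_n * 'I_n) : p \in index_set A -> (i_min A <= p.1)%N.
Proof.
move=> pI; rewrite /i_min -Order.NatOrder.minEnat -leEnat.
exact: (@Order.TotalTheory.bigmin_le_cond _ _ _ _ p).
Qed.

Lemma i_min_attained : index_set A <> set0 ->
  exists i j : 'I_n, (i, j) \in index_set A /\ i_min A = i.
Proof.
move/eqP/set0Pn => [p pI].
rewrite /i_min -Order.NatOrder.minEnat.
rewrite (Order.TotalTheory.bigmin_eq_arg _ _ _ _ pI) // => [|q _]; last first.
  by rewrite leEnat ltnW.
case: Order.TotalTheory.arg_minP => // -[i j] ijI _.
by exists i, j.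
Qed.

Lemma period_gcd_dvd (i j : 'I_n) :
  (i, j) \in index_set A -> (period_gcd A %| j - i - 1)%N.
Proof.
move=> ij; have d_lt : (j - i - 1 < n)%N by have := ltn_ord j; lia.
have dI : Ordinal d_lt \in I1 A :|: I2 A.
  rewrite !inE; apply/orP; left; apply/existsP; exists i.
  by apply/existsP; exists j; rewrite ij eqxx.
by rewrite /period_gcd (bigD1 (Ordinal d_lt)) //= dvdn_gcdl.
Qed.

(** Each element of [I2] is a difference of two elements of [I1], so a property
    of all of [I1] reaches [I2] by subtraction and then the gcd. *)
Lemma period_gcd_ind (P : nat -> Prop) :
  P 0%N -> (forall d d', P d -> P d' -> P (gcdn d d')) ->
  (forall d d', P d -> P (d' + d)%N -> P d') ->
  (forall i j : 'I_n, (i, j) \in index_set A -> P (j - i - 1)%N) ->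
  P (period_gcd A).
Proof.
move=> P0 Pgcd Psub PI; apply: big_ind => // d; rewrite !inE => /orP[].
  case/existsP=> i /existsP[j /andP[ij /eqP->]]; exact: PI.
case/existsP=> i /existsP[j /existsP[k /and4P[ij ik _ /eqP->]]].
have [/PI Pij /PI Pik] := (ij, ik).
have [[ij1 _] [ik1 _]] := (index_setP ij, index_setP ik).
case: (leqP j k) => jk.
  have kE : (k - i - 1 = `|k - j| + (j - i - 1))%N by lia.
  by apply: Psub Pij _; rewrite -kE.
have jE : (j - i - 1 = `|k - j| + (k - i - 1))%N by lia.
by apply: Psub Pik _; rewrite -jE.
Qed.

Lemma orbit_iter (r : nat -> K) (a k : nat) :
  (forall i, (i.+1 < n)%N -> r i != pole K /\ f (r i) = r i.+1) ->
  (a + k < n)%N -> r (a + k)%N = iter k (@f K) (r a).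
Proof.
move=> r_orb; elim: k => [|k IHk] akn; first by rewrite addn0.
rewrite addnS in akn *.
by rewrite iterS -IHk ?(ltnW akn) // (r_orb _ akn).2.
Qed.

(** The constraint attached to (i, j) makes r_(i+1) a point of period
    j - i - 1.  A pair with the least first index puts the point at position
    [(i_min A).+1] on a cycle containing all the later constrained points, so
    the constraints together say that this single point has period
    [period_gcd A].  The orbit of that point over one such period stays among
    the positions where the pole is already excluded. *)
Lemma compatible_orbit_Per (r : nat -> K) : index_set A <> set0 ->
  (forall i, (i.+1 < n)%N -> r i != pole K /\ f (r i) = r i.+1) ->
  compatible_orbit A r <-> Per (period_gcd A) (r (i_min A).+1).
Proof.
move=> A_neq0 r_orb; have orb := orbit_iter r_orb.
have [i0 [j0 [ij0 i0E]]] := i_min_attained A_neq0.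
have i0_le (i j : 'I_n) : (i, j) \in index_set A -> (i0 <= i)%N.
  by move=> /i_min_le; rewrite i0E.
have [i0j0 j0n] := index_setP ij0; rewrite i0E.
split=> [[_ r_supp]|[_ per]]; last first.
  split=> // i j ij; have [ltij jn] := index_setP ij.
  have i0i := i0_le i j ij.
  have /dvdnP[q qE] := period_gcd_dvd ij.
  have -> : j = (i0.+1 + ((i - i0) + (j - i - 1)))%N :> nat by lia.
  have -> : i.+1 = (i0.+1 + (i - i0))%N by lia.
  rewrite !orb; [|lia|lia].
  by rewrite iterD qE iter_period_mul.
have per (i j : 'I_n) :
    (i, j) \in index_set A -> iter (j - i - 1) (@f K) (r i.+1) = r i.+1.
  move=> ij; have [ltij jn] := index_setP ij.
  rewrite -orb; last by lia.
  by rewrite -(r_supp i j ij); congr r; lia.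
have per0 := per _ _ ij0.
have d0_gt0 : (0 < j0 - i0 - 1)%N by lia.
split; last first.
  apply: (period_gcd_ind (P := fun d => iter d _ _ = _)) => //.
  - exact: iter_period_gcd.
  - exact: iter_period_sub.
  move=> i j ij; have [ltij jn] := index_setP ij.
  have i0i := i0_le i j ij.
  (* Completing i - i0 steps to a multiple of the period of (i0, j0). *)
  apply: (@iter_period_shift _ _ _ _
    ((i - i0) * (j0 - i0 - 1) - (i - i0)) (i - i0)).
    by rewrite subnKC ?iter_period_mul // leq_pmulr.
  have iE : (i0.+1 + (i - i0) = i.+1)%N by lia.
  by rewrite -orb; [rewrite iE; apply: per|lia].
move=> l lm; have := dvdn_leq d0_gt0 (period_gcd_dvd ij0) => m_le.
rewrite -orb; last by lia.
by apply: (r_orb _ _).1; lia.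
Qed.

End IndexSet.

(** * The classification over the real and complex numbers *)

Lemma scalars_two_neq0 (F : realType) (g : ground) : (2%:R : scalars F g) != 0.
Proof. by case: g; rewrite Num.Theory.pnatr_eq0. Qed.

Theorem theorem5p2 (F : realType) (g : ground) (n : nat) (n_gt0 : (0 < n)%N)
    (E : vectType (scalars F g)) (e : n.-tuple E)
    (mul : {bilinear E -> E -> E}) (A : 'M[scalars F g]_n)
    (E_evol : evolution_algebra A e mul) (A_normal : normal_form A)
    (R : 'End(E)) :
  (index_set A = set0 ->
    (RB1_triangle e mul R <->
     exists alpha beta : scalars F g,
       [/\ forall k : nat, (k.+1 < n)%N -> ~ f_preimage_pole k alpha,
           R e`_0 = alpha *: e`_0 + beta *: e`_n.-1
         & forall i : nat, (0 < i < n)%N ->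
             R e`_i = iter i (@f (scalars F g)) alpha *: e`_i]))
  /\
  (index_set A <> set0 ->
    (RB1_triangle e mul R <->
     exists (alpha beta : scalars F g) (lambda : n.-tuple (scalars F g)),
       [/\ Per (period_gcd A) alpha,
           lambda`_(i_min A).+1 = alpha,
           forall i : nat, (i.+1 < n)%N ->
             lambda`_i != pole (scalars F g) /\ f lambda`_i = lambda`_i.+1,
           R e`_0 = lambda`_0 *: e`_0 + beta *: e`_n.-1
         & forall i : nat, (0 < i < n)%N -> R e`_i = lambda`_i *: e`_i])).
Proof.
case: n n_gt0 e A E_evol A_normal => // {}n _ e A.
move=> E_evol A_normal /=; have two_neq0 := scalars_two_neq0 F g.
split=> [A0|A_neq0]; split.
- case/(RB1_triangle_orbit two_neq0 E_evol A_normal).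
  move=> r [beta [[r_orb _] R0 Ri]].
  have orb k : (k < n.+1)%N -> r k = iter k (@f _) (r 0%N).
    by move=> kn; rewrite -[k in LHS]add0n (orbit_iter r_orb).
  exists (r 0%N), beta; split=> // [k kn [_]|i i_n].
    by rewrite -orb ?(ltnW kn) //; apply/eqP; case: (r_orb k kn).
  by rewrite Ri // orb //; case/andP: i_n.
- case=> alpha [beta [no_pole R0 Ri]].
  apply: (compatible_orbit_RB1 two_neq0 E_evol A_normal
    (r := fun i => iter i (@f _) alpha) (beta := beta)) => //.
  split=> [i|i j]; last by rewrite A0 inE.
  (* Meeting the pole for the first time at i is what no_pole forbids. *)
  elim/ltn_ind: i => i IHi i_n; split=> //; apply/eqP => i_pole.
  apply: (no_pole i i_n); split=> // l li.
  by have [] := IHi l li (ltn_trans (li : (l.+1 < i.+1)%N) i_n).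
- case/(RB1_triangle_orbit two_neq0 E_evol A_normal) => r [beta [r_comp R0 Ri]].
  have [r_orb _] := r_comp.
  have [i0 [j0 [/index_setP[ij jn] i0E]]] := i_min_attained A_neq0.
  have nthE i : (i < n.+1)%N -> [tuple r k | k < n.+1]`_i = r i.
    move=> i_n; rewrite -[i in LHS]/(nat_of_ord (Ordinal i_n)).
    by rewrite -tnth_nth tnth_mktuple.
  exists (r (i_min A).+1), beta, [tuple r k | k < n.+1]; split.
  + exact/compatible_orbit_Per.
  + by rewrite nthE // i0E; lia.
  + by move=> i i_n; rewrite !nthE ?(ltnW i_n) //; apply: r_orb.
  + by rewrite nthE.
  + by move=> i i_n; rewrite nthE ?Ri //; case/andP: i_n.
case=> alpha [beta [lambda [per lambdaE orb R0 Ri]]].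
apply: (compatible_orbit_RB1 two_neq0 E_evol A_normal _ R0 Ri).
by apply/compatible_orbit_Per; rewrite ?lambdaE.
Qed.
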